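(* Let $\mathfrak{E},\mathfrak{H},\mathfrak{K}$ be Hilbert spaces, let $A\in\mathbf{B}(\mathfrak{E},\mathfrak{H})$ and $B\in\mathbf{B}(\mathfrak{E},\mathfrak{K})$, and let $L(A,B)=\{\{Af,Bf\}:f\in\mathfrak{E}\}$. Let $C_A\in\mathbf{B}(\mathfrak{E},\mathfrak{H})$ and $C_B\in\mathbf{B}(\mathfrak{E},\mathfrak{K})$ be the uniquely determined operators satisfying $$A=C_A(A^*A+B^*B)^{1/2},\qquad B=C_B(A^*A+B^*B)^{1/2},$$ $$\operatorname{ran}(C_A)^*\subset\overline{\operatorname{ran}}(A^*A+B^*B),\qquad \operatorname{ran}(C_B)^*\subset\overline{\operatorname{ran}}(A^*A+B^*B).$$ Then the linear relation $L(C_A,C_B)$ is closed and $$L(A,B)^{**}=L(C_A,C_B)=\{\{C_A\varphi,C_B\varphi\}:\varphi\in\mathfrak{E}\}=C_B(C_A)^{-1}.$$ Consequently, the orthogonal operator part of $L(A,B)^{**}$ is given by $$(L(A,B)^{**})_{\rm s}=\{\{C_A\varphi,C_B\varphi\}:\varphi\in(\ker C_A)^\perp\}=C_B(C_A)^{(-1)}.$$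
   Context: $\mathbf{B}(\mathfrak{X},\mathfrak{Y})$ denotes the everywhere defined bounded linear operators from the Hilbert space $\mathfrak{X}$ to the Hilbert space $\mathfrak{Y}$. A linear relation $T$ from $\mathfrak{H}$ to $\mathfrak{K}$ is a linear subspace of $\mathfrak{H}\times\mathfrak{K}$, with elements written $\{f,g\}$; operators are identified with their graphs. $T^{**}$ is the closure of $T$; $\operatorname{mul}T=\{g:\{0,g\}\in T\}$; $T^{-1}=\{\{g,f\}:\{f,g\}\in T\}$; the product of relations is $ST=\{\{f,h\}:\{f,g\}\in T,\{g,h\}\in S\text{ for some }g\}$. For bounded operators $C\in\mathbf{B}(\mathfrak{E},\mathfrak{H})$, $D\in\mathbf{B}(\mathfrak{E},\mathfrak{K})$, $L(C,D)=\{\{Cf,Df\}:f\in\mathfrak{E}\}$. For a closed relation $T$ its orthogonal operator part is $T_{\rm s}=\{\{f,g\}\in T: g\perp\operatorname{mul}T\}$. The Moore-Penrose inverse $(C_A)^{(-1)}$ is the operator from $\operatorname{ran}C_A\subset\mathfrak{H}$ to $(\ker C_A)^\perp\subset\mathfrak{E}$ which maps $\psi\in\operatorname{ran}C_A$ to the unique $\varphi\in(\ker C_A)^\perp$ with $C_A\varphi=\psi$. $\overline{\operatorname{ran}}$ denotes the closure of the range. *)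

(* Defs.v *)
From HB Require Import structures.
From mathcomp Require Import all_boot all_order all_algebra.
From mathcomp Require Import sesquilinear complex.
From mathcomp Require Import all_classical all_reals all_analysis.

Set Implicit Arguments.
Unset Strict Implicit.
Unset Printing Implicit Defensive.

Import Order.TTheory GRing.Theory Num.Theory.
Import numFieldNormedType.Exports.

Local Open Scope classical_set_scope.
Local Open Scope ring_scope.
Local Open Scope complex_scope.

(* Complex Hilbert spaces.  The form [hdot] is linear in its first argument
   and conjugate-linear in the second. *)
HB.mixin Record NormedModule_isHilbert (R : realType) V
    of CompleteNormedModule R[i] V := {
  hdot : {dot V for Num.conj} ;
  hdot_norm : forall x : V, hdot x x = `|x| ^+ 2
}.

#[short(type="hilbertType")]
HB.structure Definition Hilbert (R : realType) :=
  {V of NormedModule_isHilbert R V & CompleteNormedModule R[i] V}.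

Notation "''[' x , y ]" := (hdot x y) : ring_scope.

Section Operators.
Context {R : realType}.
Implicit Types X Y Z : hilbertType R.

Definition bounded_op X Y (T : {linear X -> Y}) : Prop :=
  bounded_near T (nbhs (0 : X)).

Definition is_adjoint X Y (T : {linear X -> Y}) (Ts : {linear Y -> X}) : Prop :=
  bounded_op Ts /\ forall x y, '[T x, y] = '[x, Ts y].

(* [0 <= z] in [R[i]] entails that [z] is real, so that [S] is selfadjoint. *)
Definition is_sqrt X (S : {linear X -> X}) (T : X -> X) : Prop :=
  [/\ bounded_op S, forall x, 0 <= '[S x, x] & S \o S =1 T].

Definition ker X Y (T : X -> Y) : set X := [set x | T x = 0].

Definition orthocompl X (M : set X) : set X :=
  [set x | forall y, M y -> '[x, y] = 0].

(* Relations from [X] to [Y] are subsets of [X * Y]; the closure of such a set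
   is taken in the product topology, which is that of the Hilbert space sum. *)
Definition linear_relation X Y (T : set (X * Y)) : Prop :=
  T 0 /\ forall (a : R[i]) u v, T u -> T v -> T (a *: u + v).

Definition graph X Y (T : X -> Y) : set (X * Y) := [set u | u.2 = T u.1].

Definition pair_relation Z X Y (C : Z -> X) (D : Z -> Y) : set (X * Y) :=
  [set u | exists f, u = (C f, D f)].

Definition mul X Y (T : set (X * Y)) : set Y := [set g | T (0, g)].

Definition operator_part X Y (T : set (X * Y)) : set (X * Y) :=
  [set u | T u /\ orthocompl (mul T) u.2].

(* The graph of the Moore-Penrose inverse: its domain is [range T], since
   [T] maps the orthogonal complement of its kernel bijectively onto it. *)
Definition moore_penrose X Y (T : X -> Y) : set (Y * X) :=
  [set u | orthocompl (ker T) u.2 /\ T u.2 = u.1].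

End Operators.

(* Main.v *)
Require Import Defs.
From HB Require Import structures.
From mathcomp Require Import all_boot all_order all_algebra.
From mathcomp Require Import sesquilinear complex.
From mathcomp Require Import all_classical all_reals all_analysis.
From mathcomp Require Import ring.
Import numFieldNormedType.Exports.
Import Order.TTheory GRing.Theory Num.Theory.
Local Open Scope classical_set_scope.
Local Open Scope ring_scope.

(** The proof is about the column operator [C = (CA, CB)] from [E] to the
    Hilbert space sum of [H] and [K], whose range is [pair_relation CA CB].
    Write [M = A^* A + B^* B = S S] and [Q = C^* C = CA^* CA + CB^* CB].

    Since [C S x = (A x, B x)] and [S] is selfadjoint, [S Q S = M = S S]; that
    is, [C] is isometric on [ran S].  The range conditions on [CA^*] and [CB^*]
    say that [Q] takes its values in the closure of [ran M] and that [C]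
    vanishes on the orthogonal complement of [ran M], which is also the kernel
    of [S].  Together they make [Q] the orthogonal projection onto the closure
    of [ran M], so that [C Q = C]: the column is a partial isometry
    ([column_partial_isometry]).  The identity [C Q = C] is reached by testing
    against [ran M], where [Q] is seen to act as the identity.

    Everything else follows from [C Q = C].
    - [ran C] is closed, being the solution set of the continuous equation
      [C (C^* u) = u] ([closed_pair_relation]).
    - [L(A, B) = C (ran S)] is contained in [ran C], and is dense in it because
      [C phi = C (Q phi)] where [Q phi] is a limit of vectors [M z], for which
      [C (M z) = (A (S z), B (S z))].
    - For [psi] in [ker CA] one has [<Q phi, psi> = <CB phi, CB psi>].  As the
      vectors [CB psi] run through [mul (ran C)], the pair [C phi] belongs to
      the operator part exactly when [Q phi] is orthogonal to [ker CA], and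
      [C phi = C (Q phi)] ([operator_part_pair_relation]). *)

(** * Closed sets and closures *)

Lemma normed_closed_set1 {K : numFieldType} {V : pseudoMetricNormedZmodType K}
    (x : V) : closed [set x].
Proof.
apply: accessible_closed_set1; apply: hausdorff_accessible.
exact: norm_hausdorff.
Qed.

Lemma closed_eqfun {K : numFieldType} {T : topologicalType}
    {V : pseudoMetricNormedZmodType K} (f g : T -> V) :
  continuous f -> continuous g -> closed [set u | f u = g u].
Proof.
move=> cf cg.
have -> : [set u | f u = g u] = (fun u => f u - g u) @^-1` [set 0].
  by apply/seteqP; split=> u /= => [->|/subr0_eq//]; rewrite subrr.
have cfg : continuous (fun u => f u - g u).
  by move=> u; apply: cvgB; [exact: cf|exact: cg].
move/continuous_closedP: cfg; apply.
exact: normed_closed_set1.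
Qed.

Lemma closure_preimage {T U : topologicalType} {f : T -> U} {A : set T}
    {D : set U} :
  continuous f -> closed D -> A `<=` f @^-1` D -> closure A `<=` f @^-1` D.
Proof.
move=> /continuous_closedP cf /cf /closure_id clD AD.
by rewrite clD; exact: closureS.
Qed.

(** * Inner products *)

Section InnerProduct.
Context {R : realType}.
Implicit Types X Y : hilbertType R.

Lemma hdotC {X} (x y : X) : '[x, y] = ('[y, x])^*.
Proof.
by rewrite (hermC (hdot : {hermitian X for false & Num.conj})) expr0 mul1r.
Qed.

Lemma hdot_eq0 {X} (x : X) : '[x, x] = 0 -> x = 0.
Proof.
by rewrite hdot_norm => /eqP; rewrite expf_eq0 /= normr_eq0 => /eqP.
Qed.

Lemma hdotDl {X} (x y z : X) : '[x + y, z] = '[x, z] + '[y, z].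
Proof. exact: linearDl. Qed.

Lemma hdotDr {X} (x y z : X) : '[x, y + z] = '[x, y] + '[x, z].
Proof. exact: linearDr. Qed.

Lemma hdotNl {X} (x y : X) : '[- x, y] = - '[x, y].
Proof. exact: linearNl. Qed.

Lemma hdotNr {X} (x y : X) : '[x, - y] = - '[x, y].
Proof. exact: linearNr. Qed.

Lemma hdotZl {X} a (x y : X) : '[a *: x, y] = a * '[x, y].
Proof. exact: linearZl_LR. Qed.

Lemma hdotZr {X} a (x y : X) : '[x, a *: y] = a^* * '[x, y].
Proof. exact: linearZr_LR. Qed.

Definition hdot_expand {X} :=
  (@hdotDl X, @hdotDr X, @hdotNl X, @hdotNr X, @hdotZl X, @hdotZr X).

Lemma hdot_inj {X} (x y : X) : (forall z, '[x, z] = '[y, z]) -> x = y.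
Proof.
move=> xy; apply/eqP; rewrite -subr_eq0; apply/eqP/hdot_eq0.
by rewrite hdotDl hdotNl xy subrr.
Qed.

(** Over the complex numbers a sesquilinear form is determined by its diagonal.
    With the identity for [S] this writes the inner product through norms,
    whence its continuity; in general it transfers reality of the quadratic
    form of [S] to symmetry of [S]. *)
Lemma polarization {X} (S : {linear X -> X}) (x y : X)
    (q := fun z => '[S z, z]) :
  4 * '[S x, y] = q (x + y) - q (x - y)
                  + 'i * (q (x + 'i *: y) - q (x - 'i *: y)).
Proof.
rewrite /q !(linearD S, linearN S, linearZ_LR S) /= !hdot_expand conjCi.
have := sqrCi R[i]; set j := 'i => j2.
ring: j2.
Qed.

Lemma nonneg_selfadjoint {X} (S : {linear X -> X}) :
  (forall x, 0 <= '[S x, x]) -> forall x y, '[S x, y] = '[x, S y].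
Proof.
move=> S0 x y.
have qR z : ('[S z, z])^* = '[S z, z] by exact/CrealP/ger0_real.
apply: (@mulfI _ 4); first by rewrite pnatr_eq0.
rewrite polarization [in RHS]hdotC -(conjC_nat _ 4) -rmorphM /= polarization.
rewrite !(rmorphD, rmorphN, rmorphM) /= conjCi !qR.
rewrite !(linearD S, linearN S, linearZ_LR S) /= !hdot_expand conjCi.
have := sqrCi R[i]; set j := 'i => j2.
ring: j2.
Qed.

(** The norm is continuous and determines the inner product by polarization.
    The cast to [numFieldType] selects the norm topology on [R[i]]. *)
Lemma hdot_continuousl {X} (y : X) :
  continuous (fun x : X => '[x, y] : (R[i] : numFieldType)).
Proof.
have normT (z : X) :
    continuous (fun x : X => `|x + z| ^+ 2 : (R[i] : numFieldType)).
  have norm1 : continuous (fun x : X => `|x + z| : (R[i] : numFieldType)).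
    by move=> x; apply: cvg_norm; apply: cvgD; [exact: cvg_id|exact: cvg_cst].
  by move=> x; apply: cvgM; exact: norm1.
have -> : (fun x : X => '[x, y]) = (fun x => 4^-1 *
    (`|x + y| ^+ 2 - `|x - y| ^+ 2
     + 'i * (`|x + 'i *: y| ^+ 2 - `|x - 'i *: y| ^+ 2))).
  apply/funext => x; apply: (@mulfI _ 4); first by rewrite pnatr_eq0.
  rewrite mulrA mulfV ?pnatr_eq0// mul1r -!hdot_norm.
  exact: (polarization idfun).
move=> x.
apply: cvgM; first exact: cvg_cst.
apply: cvgD; first by apply: cvgB; exact: normT.
by apply: cvgM; [exact: cvg_cst|apply: cvgB; exact: normT].
Qed.

Lemma bounded_op_continuous {X Y} (T : {linear X -> Y}) :
  bounded_op T -> continuous T.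
Proof. by move=> ?; exact: bounded_linear_continuous. Qed.

Lemma orthocompl_closure {X} (M : set X) :
  orthocompl M `<=` orthocompl (closure M).
Proof.
move=> x xM y /(closure_preimage (hdot_continuousl x) (D := [set 0])) My.
rewrite hdotC My ?conjC0//.
  exact: normed_closed_set1.
by move=> z Mz; rewrite /= hdotC xM// conjC0.
Qed.

Lemma closure_addr {X} (M : set X) :
    (forall x y, M x -> M y -> M (x + y)) ->
  forall x y, closure M x -> closure M y -> closure M (x + y).
Proof.
move=> MD x y Mx My.
have shift z : continuous (fun t : X => t + z).
  by move=> t; apply: cvgD; [exact: cvg_id|exact: cvg_cst].
have cl : closed (closure M) by exact: closed_closure.
apply: (closure_preimage (shift y) cl) Mx => t Mt /=.
rewrite addrC; apply: (closure_preimage (shift t) cl) My => u Mu /=.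
by apply: subset_closure; exact: MD.
Qed.

(** A vector [x] orthogonal to [ran Ts] is killed by [T], because
    [<T x, T x> = <x, Ts (T x)>]. *)
Lemma ker_adjoint {X Y} {T : {linear X -> Y}} {Ts : {linear Y -> X}}
    {M : set X} :
  is_adjoint T Ts -> range Ts `<=` closure M -> orthocompl M `<=` ker T.
Proof.
move=> [_ adjT] ranT x /orthocompl_closure xM.
by apply: hdot_eq0; rewrite adjT; apply: xM; apply: ranT; exists (T x).
Qed.

(** * Columns of operators and their ranges *)

Section Column.
Context {E H K : hilbertType R}.
Implicit Types (CA : {linear E -> H}) (CB : {linear E -> K}).
Implicit Types (CAs : {linear H -> E}) (CBs : {linear K -> E}).

Lemma linear_pair_relation CA CB : linear_relation (pair_relation CA CB).
Proof.
split; first by exists 0; rewrite !linear0.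
by move=> a _ _ [f ->] [g ->]; exists (a *: f + g); rewrite !linearP.
Qed.

Lemma pair_relationE CA CB :
  pair_relation CA CB = (graph CB \; (graph CA)^-1)%relation.
Proof.
apply/seteqP; split=> [_ [f ->]|[h k] [f /= hE kE]]; first by exists f.
by exists f; congr (_, _).
Qed.

(** The operator [C^* C] of the column [C = (CA, CB)]. *)
Definition pair_gram CA CB CAs CBs : E -> E := (CAs \o CA) \+ (CBs \o CB).

Lemma pair_gramE {CA CB CAs CBs} (x y : E) :
  is_adjoint CA CAs -> is_adjoint CB CBs ->
  '[pair_gram CA CB CAs CBs x, y] = '[CA x, CA y] + '[CB x, CB y].
Proof.
move=> [_ aA] [_ aB]; rewrite /pair_gram /= hdotDl.
by rewrite hdotC -aA -hdotC [in X in _ + X]hdotC -aB -hdotC.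
Qed.

Lemma pair_gram_sym {CA CB CAs CBs} (x y : E) :
  is_adjoint CA CAs -> is_adjoint CB CBs ->
  '[pair_gram CA CB CAs CBs x, y] = '[x, pair_gram CA CB CAs CBs y].
Proof.
move=> aA aB; rewrite pair_gramE// [RHS]hdotC pair_gramE//.
by rewrite rmorphD /= -!hdotC.
Qed.

Lemma pair_continuous CA CB : continuous CA -> continuous CB ->
  continuous (fun f => (CA f, CB f)).
Proof. by move=> cA cB x; apply: cvg_pair; [exact: cA|exact: cB]. Qed.

(** The two equations say [C Q = C], which makes [C (C^* u) = u] hold on
    [ran C]; conversely every solution [u] is in [ran C].  So [ran C] is the
    set on which two continuous maps agree. *)
Lemma closed_pair_relation {CA CB CAs CBs}
    (Q := pair_gram CA CB CAs CBs) :
  bounded_op CA -> bounded_op CB -> bounded_op CAs -> bounded_op CBs ->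
  CA \o Q =1 CA -> CB \o Q =1 CB -> closed (pair_relation CA CB).
Proof.
move=> /bounded_op_continuous cA /bounded_op_continuous cB.
move=> /bounded_op_continuous cAs /bounded_op_continuous cBs QA QB.
pose F (u : H * K) := CAs u.1 + CBs u.2.
have cF : continuous F.
  move=> u; apply: cvgD.
    by apply: (@continuous_comp _ _ _ fst CAs); [exact: cvg_fst|exact: cAs].
  by apply: (@continuous_comp _ _ _ snd CBs); [exact: cvg_snd|exact: cBs].
have -> : pair_relation CA CB =
    [set u | CA (F u) = u.1] `&` [set u | CB (F u) = u.2].
  apply/seteqP; split=> [_ [f ->]|[h k] [/= hE kE]].
    by split; [exact: QA|exact: QB].
  by exists (F (h, k)); rewrite hE kE.
apply: closedI; apply: closed_eqfun.
- by move=> u; apply: (@continuous_comp _ _ _ F CA); [exact: cF|exact: cA].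
- by move=> u; exact: cvg_fst.
- by move=> u; apply: (@continuous_comp _ _ _ F CB); [exact: cF|exact: cB].
- by move=> u; exact: cvg_snd.
Qed.

(** Since [CB (ker CA)] is the multivalued part, the pair [C phi] is in the
    operator part when [CB phi] is orthogonal to [CB psi] for all [psi] in
    [ker CA]; as [<CB phi, CB psi> = <Q phi, psi>] there, this is orthogonality
    of [Q phi] to [ker CA].  Replacing [phi] by [Q phi] does not change the
    pair. *)
Lemma operator_part_pair_relation {CA CB CAs CBs}
    (Q := pair_gram CA CB CAs CBs) :
  is_adjoint CA CAs -> is_adjoint CB CBs ->
  CA \o Q =1 CA -> CB \o Q =1 CB ->
  operator_part (pair_relation CA CB)
    = [set (CA phi, CB phi) | phi in orthocompl (ker CA)].
Proof.
move=> aA aB QA QB.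
have kerE phi psi : ker CA psi -> '[Q phi, psi] = '[CB phi, CB psi].
  by move=> psi0; rewrite pair_gramE// (psi0 : CA psi = 0) raddf0 add0r.
apply/seteqP; split=> [_ [[phi ->] /= phiT]|_ [phi phiA <-]].
  exists (Q phi); last by congr (_, _); [exact: QA|exact: QB].
  move=> psi psi0; rewrite kerE//; apply: phiT; exists psi.
  by rewrite (psi0 : CA psi = 0).
(* [Q phi - phi] is killed by the column, so it is orthogonal both to [phi],
   by hypothesis, and to [Q phi]. *)
have Qphi : Q phi = phi.
  have dA : ker CA (Q phi - phi).
    by rewrite /ker /= raddfB /= [CA _]QA subrr.
  have dB : CB (Q phi - phi) = 0 by rewrite raddfB /= [CB _]QB subrr.
  apply/eqP; rewrite -subr_eq0; apply/eqP/hdot_eq0.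
  rewrite [LHS]hdotDl kerE// dB hdotNl (phiA _ dA).
  by rewrite [X in X - _]linear0r subr0.
split; first by exists phi.
by move=> _ [psi [/esym psi0 ->]] /=; rewrite -kerE// Qphi; exact: phiA.
Qed.

(** Factoring a column [(A, B)] through the square root [S] of its Gram operator
    [M] leaves a partial isometry, provided that the factors vanish where [S]
    does.  On [ran M] the identity [Q (M z) = M z] holds: the difference [d] is
    in [ker S] by [S Q S = S S], hence is orthogonal to [ran M] and is killed by
    the column, and then [<d, d> = - <d, Q (M z)> = - <Q d, M z> = 0].  By
    symmetry of [Q], each [x - Q x] is therefore orthogonal to [ran M]. *)
Lemma column_partial_isometry {A : {linear E -> H}} {B : {linear E -> K}}
    {As : {linear H -> E}} {Bs : {linear K -> E}} {S : {linear E -> E}}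
    {CA CB CAs CBs} (Q := pair_gram CA CB CAs CBs) (M := pair_gram A B As Bs) :
  is_adjoint A As -> is_adjoint B Bs ->
  is_adjoint CA CAs -> is_adjoint CB CBs ->
  (forall x y, '[S x, y] = '[x, S y]) -> S \o S =1 M ->
  A =1 CA \o S -> B =1 CB \o S ->
  orthocompl (range M) `<=` ker CA -> orthocompl (range M) `<=` ker CB ->
  CA \o Q =1 CA /\ CB \o Q =1 CB.
Proof.
move=> aA aB aCA aCB symS SS eqA eqB kerA kerB.
have CAS z : CA (S z) = A z := esym (eqA z).
have CBS z : CB (S z) = B z := esym (eqB z).
have SQS z : S (Q (S z)) = S (S z).
  apply: hdot_inj => w.
  by rewrite symS pair_gramE// !CAS !CBS -(pair_gramE _ _ aA aB) -/M -SS.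
have QM z : Q (M z) = M z.
  pose d := M z - Q (M z).
  have dM : orthocompl (range M) d.
    move=> _ [w _ <-]; rewrite -(SS w) /= -symS /d raddfB /= -(SS z) /= SQS.
    by rewrite subrr linear0l.
  have Qd : Q d = 0.
    rewrite /Q /pair_gram /= (kerA _ dM : CA d = 0) (kerB _ dM : CB d = 0).
    by rewrite !raddf0 addr0.
  apply/esym/eqP; rewrite -subr_eq0 -/d; apply/eqP/hdot_eq0.
  rewrite {2}/d hdotDr hdotNr dM; last by exists z.
  by rewrite -pair_gram_sym// -/Q Qd linear0l subr0.
have perpQ x : orthocompl (range M) (x - Q x).
  by move=> _ [z _ <-]; rewrite hdotDl hdotNl pair_gram_sym// -/Q QM subrr.
split=> x /=; apply/esym/eqP; rewrite -subr_eq0 -raddfB; apply/eqP.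
  exact: kerA (perpQ x).
exact: kerB (perpQ x).
Qed.

End Column.

End InnerProduct.

(** * The closure of the relation and its operator part *)

Theorem theorem4p4 (R : realType) (E H K : hilbertType R)
  (* A, B and their adjoints *)
  (A : {linear E -> H}) (B : {linear E -> K})
  (As : {linear H -> E}) (Bs : {linear K -> E})
  (bA : bounded_op A) (bB : bounded_op B)
  (adjA : is_adjoint A As) (adjB : is_adjoint B Bs)
  (* S = (A^* A + B^* B)^(1/2) *)
  (S : {linear E -> E}) (sqS : is_sqrt S ((As \o A) \+ (Bs \o B)))
  (* C_A, C_B and their adjoints *)
  (CA : {linear E -> H}) (CB : {linear E -> K})
  (CAs : {linear H -> E}) (CBs : {linear K -> E})
  (bCA : bounded_op CA) (bCB : bounded_op CB)
  (adjCA : is_adjoint CA CAs) (adjCB : is_adjoint CB CBs)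
  (eqA : A =1 CA \o S) (eqB : B =1 CB \o S)
  (ranCA : range CAs `<=` closure (range ((As \o A) \+ (Bs \o B))))
  (ranCB : range CBs `<=` closure (range ((As \o A) \+ (Bs \o B)))) :
  [/\ linear_relation (pair_relation CA CB) /\ closed (pair_relation CA CB),
      closure (pair_relation A B) = pair_relation CA CB,
      pair_relation CA CB = [set (CA phi, CB phi) | phi in [set: E]],
      pair_relation CA CB = (graph CB \; (graph CA)^-1)%relation &
      operator_part (closure (pair_relation A B))
        = [set (CA phi, CB phi) | phi in orthocompl (ker CA)] /\
      operator_part (closure (pair_relation A B))
        = (graph CB \; moore_penrose CA)%relation].
Proof.
have [_ S0 SS] := sqS.
set M := (As \o A) \+ (Bs \o B) in SS ranCA ranCB.
set Q := pair_gram CA CB CAs CBs.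
have [QA QB] : CA \o Q =1 CA /\ CB \o Q =1 CB.
  apply: (column_partial_isometry adjA adjB adjCA adjCB _ SS eqA eqB).
  - exact: nonneg_selfadjoint.
  - exact: ker_adjoint adjCA ranCA.
  - exact: ker_adjoint adjCB ranCB.
have clC : closed (pair_relation CA CB).
  exact: closed_pair_relation bCA bCB adjCA.1 adjCB.1 QA QB.
have clAB : closure (pair_relation A B) = pair_relation CA CB.
  apply/seteqP; split.
    rewrite [X in _ `<=` X](closure_id _).1//; apply: closureS => _ [f ->].
    by exists (S f); rewrite eqA eqB.
  have sub : closure (range M) `<=`
      (fun f => (CA f, CB f)) @^-1` closure (pair_relation A B).
    apply: closure_preimage.
    - by apply: pair_continuous; exact: bounded_op_continuous.
    - exact: closed_closure.
    - move=> _ [z _ <-] /=; rewrite -SS /= -[CA _]eqA -[CB _]eqB.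
      by apply: subset_closure; exists (S z).
  (* [Q phi = CAs (CA phi) + CBs (CB phi)] is in the closure of [ran M]. *)
  move=> _ [phi ->]; rewrite -QA -QB; apply: (sub (Q phi)).
  apply: closure_addr.
  - move=> _ _ [x _ <-] [y _ <-]; exists (x + y) => //.
    by rewrite /M /= !linearD addrACA.
  - by apply: ranCA; exists (CA phi).
  - by apply: ranCB; exists (CB phi).
have opE := operator_part_pair_relation adjCA adjCB QA QB.
split.
- by split; [exact: linear_pair_relation|].
- exact: clAB.
- by apply/seteqP; split=> [_ [f ->]|_ [f _ <-]]; exists f.
- exact: pair_relationE.
- rewrite clAB opE; split=> //.
  apply/seteqP; split=> [_ [f fA <-]|[h k] [f /= [fA hE] kE]].
    by exists f.
  by exists f => //; congr (_, _); [exact: hE|exact/esym/kE].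
Qed.
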